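(* Let $G$ be a graph and let $k_1,k_2$ be positive integers with $k_1<k_2\leqslant |V(G)|$. Then $$\gamma_{k_1\text{-SRD}}(G)\leqslant\gamma_{k_2\text{-SRD}}(G)\leqslant|V(G)|.$$
   Context: All graphs are finite, simple and undirected; $N(v)$ denotes the set of neighbors of $v$ and $\Delta(G)$ the maximum degree. Let $k\geqslant 1$ be an integer with $|V(G)|\geqslant k$. An attack pattern is a set $P\subseteq V(G)$ with $|P|=k$. A function $f:V(G)\to\{0,1,\ldots,\min(\Delta(G),k)+1\}$ is a proper $k$-SRD ($k$-strong Roman domination) function if for each attack pattern $P$ every vertex $u\in P$ with $f(u)=0$ can be defended by a neighboring vertex, where each vertex $v$ with $f(v)\geqslant 2$ can defend at most $f(v)-1$ of its neighbors in $P$ labeled 0 (and vertices with label $\leqslant 1$ defend no other vertex). That is, for each $P$ there is a map $\delta_P:\{u\in P : f(u)=0\}\to V(G)$ (which may depend on $P$) such that $\delta_P(u)\in N(u)$ and $f(\delta_P(u))\geqslant 2$ for all $u$ in its domain, and $|\delta_P^{-1}(v)|\leqslant f(v)-1$ for every $v$ with $f(v)\geqslant 2$. The weight is $\omega(f)=\sum_{v\in V(G)}f(v)$, and the $k$-SRD number is $\gamma_{k\text{-SRD}}(G)=\min\{\omega(f) : f \text{ is a proper } k\text{-SRD function on } G\}$. *)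

(* Defs.v *)
From HB Require Import structures.
From mathcomp Require Import all_boot.

Set Implicit Arguments.
Unset Strict Implicit.
Unset Printing Implicit Defensive.

Record sgraph := SGraph {
  vertex :> finType;
  adj : rel vertex;
  adj_sym : symmetric adj;
  adj_irrefl : irreflexive adj
}.

Definition nbrs (G : sgraph) (v : G) : {set G} := [set w | adj v w].

Definition max_degree (G : sgraph) : nat := \max_(v : G) #|nbrs v|.

(* Labels range over {0, ..., min(Delta(G), k) + 1}, which has
   min(Delta(G), k) + 2 elements. *)
Definition labelling (G : sgraph) (k : nat) :=
  {ffun G -> 'I_(minn (max_degree G) k).+2}.

Definition weight (G : sgraph) (k : nat) (f : labelling G k) : nat :=
  \sum_(v : G) f v.

Definition attacked (G : sgraph) (k : nat) (f : labelling G k) (P : {set G}) :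
  {set G} := [set u in P | f u == 0 :> nat].

(* The defence map has domain [attacked f P]; it is encoded as a total function
   on G, whose values outside this domain are irrelevant. *)
Definition defends (G : sgraph) (k : nat) (f : labelling G k) (P : {set G})
    (d : {ffun G -> G}) : bool :=
  [forall u in attacked f P, (d u \in nbrs u) && (2 <= f (d u))] &&
  [forall v : G,
    (2 <= f v) ==> (#|[set u in attacked f P | d u == v]| <= f v - 1)].

Definition proper_srd (G : sgraph) (k : nat) (f : labelling G k) : bool :=
  [forall P : {set G}, (#|P| == k) ==> [exists d : {ffun G -> G}, defends f P d]].

Definition srd_weight (G : sgraph) (k : nat) : pred nat :=
  fun n => [exists f : labelling G k, proper_srd f && (weight f == n)].

Lemma srd_weight_nonempty (G : sgraph) (k : nat) : exists n, srd_weight G k n.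
Proof.
pose f : labelling G k := [ffun=> inord 1].
exists (weight f); apply/existsP; exists f; rewrite eqxx andbT.
have f1 u : f u = 1 :> nat by rewrite ffunE inordK.
apply/forallP => P; apply/implyP => _; apply/existsP; exists [ffun u => u].
apply/andP; split; apply/forallP => u; first by rewrite inE f1 andbF.
by rewrite f1.
Qed.

Definition srd_number (G : sgraph) (k : nat) : nat :=
  ex_minn (srd_weight_nonempty G k).

(* Main.v *)
(* Truncating a proper k2-SRD function at the largest label
   min(Delta(G), k1) + 1 allowed for k1 keeps its zeros and does not increase its
   weight. An attack pattern of size k1 extends to one of size k2, and the
   defence of the latter still works: a vertex never has to defend more than
   min(Delta(G), k1) vertices, since these are attacked neighbours of it. *)
Require Import Defs.
From mathcomp Require Import all_boot.

Lemma extend_set_card (T : finType) (A : {set T}) (n : nat) :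
  #|A| <= n <= #|T| -> exists2 B : {set T}, A \subset B & #|B| = n.
Proof.
case/andP=> leAn lenT.
have: n - #|A| <= #|~: A| by rewrite [X in _ <= X]cardsCs setCK leq_sub2r.
(* The list [s] holds [n - #|A|] distinct elements outside [A], exactly the number missing. *)
case/card_geqP=> s [s_uniq s_size sCA]; exists (A :|: [set:: s]).
  exact: subsetUl.
rewrite cardsU disjoint_setI0 ?cards0 ?subn0.
  by rewrite cardsE (card_uniqP s_uniq) s_size subnKC.
rewrite -setI_eq0 -subset0; apply/subsetP=> x; rewrite !inE => /andP[xA /sCA].
by rewrite inE xA.
Qed.

Lemma leq_max_degree (G : sgraph) (v : G) : #|nbrs v| <= max_degree G.
Proof. exact: leq_bigmax. Qed.

Lemma srd_number_le (G : sgraph) (k : nat) (f : labelling G k) :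
  proper_srd f -> srd_number G k <= weight f.
Proof.
move=> fP; rewrite /srd_number; case: ex_minnP => m _; apply.
by apply/existsP; exists f; rewrite fP eqxx.
Qed.

Lemma srd_number_attained (G : sgraph) (k : nat) :
  exists2 f : labelling G k, proper_srd f & weight f = srd_number G k.
Proof.
rewrite /srd_number; case: ex_minnP => m /existsP[f /andP[fP /eqP <-]] _.
by exists f.
Qed.

(** The constant labelling 1 has no zeros, so every attack pattern is defended vacuously. *)
Lemma srd_number_le_order (G : sgraph) (k : nat) : srd_number G k <= #|G|.
Proof.
pose f : labelling G k := [ffun=> inord 1].
have f1 u : f u = 1 :> nat by rewrite ffunE inordK.
have <-: weight f = #|G|.
  by rewrite /weight (eq_bigr (fun=> 1)) ?sum1_card.
apply: srd_number_le; apply/forallP=> P; apply/implyP=> _.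
apply/existsP; exists [ffun u => u].
by apply/andP; split; apply/forallP=> u; rewrite ?inE f1 ?andbF.
Qed.

Definition truncate (G : sgraph) (k1 k2 : nat) (f : labelling G k2) :
  labelling G k1 := [ffun v => inord (minn (f v) (minn (max_degree G) k1).+1)].

Lemma truncateE (G : sgraph) (k1 k2 : nat) (f : labelling G k2) (v : G) :
  truncate G k1 k2 f v = minn (f v) (minn (max_degree G) k1).+1 :> nat.
Proof. by rewrite ffunE inordK // ltnS geq_minr. Qed.

Lemma weight_truncate (G : sgraph) (k1 k2 : nat) (f : labelling G k2) :
  weight (truncate G k1 k2 f) <= weight f.
Proof. by apply: leq_sum => v _; rewrite truncateE geq_minl. Qed.

(** The cap is a successor, hence positive, so capping creates no new zero. *)
Lemma attacked_truncate (G : sgraph) (k1 k2 : nat) (f : labelling G k2)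
    (P : {set G}) :
  attacked (truncate G k1 k2 f) P = attacked f P.
Proof.
by apply/setP=> u; rewrite !inE truncateE; case: (nat_of_ord (f u)) => [|n];
  rewrite ?min0n // minnSS.
Qed.

Lemma proper_srd_truncate (G : sgraph) (k1 k2 : nat) (f : labelling G k2) :
  0 < k1 -> k1 <= k2 <= #|G| -> proper_srd f -> proper_srd (truncate G k1 k2 f).
Proof.
move=> k1_gt0 k12V /forallP fP; apply/forallP=> P; apply/implyP=> /eqP cardP.
have [|Q sPQ cardQ] := extend_set_card _ P k2; first by rewrite cardP.
have:= fP Q; rewrite cardQ eqxx => /existsP[d /andP[/forall_inP dN /forallP dC]].
have sPQa : attacked f P \subset attacked f Q.
  by apply/subsetP=> u; rewrite !inE => /andP[/(subsetP sPQ)-> ->].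
apply/existsP; exists d; rewrite /defends attacked_truncate.
apply/andP; split.
  apply/forall_inP=> u /(subsetP sPQa)/dN/andP[duN fdu].
  (* The capped label of [d u] stays at least 2 provided the cap is at least 2, that is, [k1] and
     the maximum degree are positive; the latter holds because [u] has the neighbour [d u]. *)
  rewrite duN truncateE leq_min fdu ltnS leq_min k1_gt0 andbT /=.
  apply: leq_trans (leq_max_degree G u).
  by apply/card_gt0P; exists (d u).
apply/forallP=> v; apply/implyP; rewrite truncateE leq_min => /andP[fv _].
(* The load of [v] must be below [f v], at most the maximum degree and at most [k1]. These follow in
   turn from the defence of [Q], from the defended vertices being neighbours of [v], and from their
   lying in [P]. *)
rewrite subn1 -ltnS prednK ?leq_min ?(ltnW fv) //.
rewrite !ltnS leq_min; apply/and3P; split.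
- apply: leq_ltn_trans (_ : f v - 1 < f v); last by rewrite subn1 ltn_predL ltnW.
  apply: leq_trans (implyP (dC v) fv); apply/subset_leq_card/subsetP=> u.
  by move=> /setIdP[/(subsetP sPQa) uQ duv]; apply/setIdP.
- apply: leq_trans (leq_max_degree G v); apply/subset_leq_card/subsetP=> u.
  move=> /setIdP[/(subsetP sPQa)/dN/andP[+ _] /eqP duv].
  by rewrite duv !inE adj_sym.
- rewrite -cardP; apply/subset_leq_card/subsetP=> u.
  by rewrite !inE => /andP[/andP[]].
Qed.

Theorem lemma1 (G : sgraph) (k1 k2 : nat) (k1_gt0 : 0 < k1) (lt_k12 : k1 < k2)
    (le_k2V : k2 <= #|vertex G|) :
  srd_number G k1 <= srd_number G k2 <= #|vertex G|.
Proof.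
rewrite srd_number_le_order andbT.
have [f fP <-] := srd_number_attained G k2.
apply: leq_trans (weight_truncate G k1 k2 f).
by apply/srd_number_le/proper_srd_truncate; rewrite // ltnW.
Qed.
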